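(* Every binary tree, meaning every rooted symmetric tree with daughter degree sequence $(2,2,\ldots,2)$, has a weakly $\alpha$-labelling.
   Context: Graceful labelling: for a finite tree $T=(V,E)$, an injective function $f:V\to\{0,1,\ldots,|E|\}$ such that the induced edge labelling $g:E\to\{1,\ldots,|E|\}$, $g(uv)=|f(u)-f(v)|$, is also injective. Weakly $\alpha$-labelling: a graceful labelling $f$ of $T$ for which there is a positive integer $k$ such that for each edge $xy$ of $T$ either $f(x)\le k\le f(y)$ or $f(y)\le k\le f(x)$. Rooted symmetric tree: a finite rooted tree in which all vertices at the same level (distance from the root) have the same degree. Levels are numbered from $1$ to $q$, where level $1$ contains only the root and level $q$ is the last level. For $1\le i\le q$, $k_i$ is the common number of daughters (adjacent vertices at level $i+1$) of each vertex at level $i$; thus $k_i\ge 1$ for $i<q$ and $k_q=0$. The finite sequence $(k_1,\ldots,k_{q-1})$ is the daughter degree sequence of $T$. Thus a binary tree here is a finite rooted tree in which every vertex not at the last level has exactly two daughters and all leaves are at the last level. *)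

(* Defs.v *)
From mathcomp Require Import all_boot all_order all_algebra.

Set Implicit Arguments.
Unset Strict Implicit.
Unset Printing Implicit Defensive.

Section Graphs.
Variables (T : finType) (e : rel T).

(* Nonemptiness is not included: a rooted tree has its root as a vertex. *)
Definition is_tree : Prop :=
  [/\ symmetric e, irreflexive e,
      forall x y : T, connect e x y
    & forall c : seq T, 2 < size c -> uniq c -> ~~ cycle e c].

Definition edges : {set {set T}} :=
  [set [set p.1; p.2] | p : T * T & e p.1 p.2].

Definition degree (v : T) : nat := #|[set w | e v w]|.

(* Least length of a walk from x to y; equal to #|T| when there is none. *)
Definition dist (x y : T) : nat :=
  find (fun n => [exists p : n.-tuple T, path e x p && (last x p == y)])
       (iota 0 #|T|).

Section Rooted.
Variable r : T.

Definition level (v : T) : nat := (dist r v).+1.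

Definition last_level : nat := \max_(v : T) level v.

Definition daughters (v : T) : {set T} :=
  [set w | e v w & level w == (level v).+1].

Definition rooted_symmetric_tree : Prop :=
  is_tree /\ forall u v : T, level u = level v -> degree u = degree v.

(* k_i is the entry of ks of index i - 1; a vertex at the last level q falls
   outside ks, where nth returns the default k_q = 0. *)
Definition daughter_degree_sequence (ks : seq nat) : Prop :=
  size ks = last_level.-1 /\
  forall v : T, #|daughters v| = nth 0 ks (level v).-1.

End Rooted.

Definition edge_label (f : T -> nat) (u v : T) : nat := `|f u - f v|%N.

Definition graceful (f : T -> nat) : Prop :=
  [/\ injective f,
      forall v : T, f v <= #|edges|,
      forall u v : T, e u v -> 0 < edge_label f u v <= #|edges|
    & forall u v u' v' : T, e u v -> e u' v' ->
        edge_label f u v = edge_label f u' v' ->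
        [set u; v] = [set u'; v'] ].

Definition weakly_alpha (f : T -> nat) : Prop :=
  graceful f /\
  exists k : nat, 0 < k /\
    forall x y : T, e x y -> f x <= k <= f y \/ f y <= k <= f x.

End Graphs.

(* Main.v *)
Require Import Defs.
From mathcomp Require Import all_boot all_order all_algebra.
From mathcomp Require Import zify.

(** Write [M = 2 ^ n.+1 - 1] for the number of vertices of the binary tree with
    [n] levels of edges, and suppose that it has a graceful labelling [g] with
    root label 0. The tree with one more level is a new root above two copies
    of it. Adding 0 or [M] to [g], according to the copy and to the parity of
    the depth, in such a way that the two ends of an edge always receive
    different shifts, uses each of the labels 0 .. 2M - 1 once. An edge of
    [g]-label [d] now has label [M + d] in one copy and [M - d] in the other, so
    every edge label below 2M except [M] occurs once. The roots of the copies
    have labels 0 and [M]; giving the label 2M to the new root creates exactly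
    the missing edge labels [M] and 2M. The reflection [x |-> 2M - x] brings the
    root label back to 0, and the induction goes on. By construction every edge
    joins a label at most [M] to a label at least [M], so the labelling is
    weakly alpha with [k = M].

    This labelling is defined on words of booleans, a word being the address of
    a vertex ([word_label], [word_label_inj], [word_edge_inj],
    [word_label_split]). To carry it over to the given graph, a parent is chosen
    for each vertex other than the root; acyclicity forces every edge to join a
    vertex to its parent ([edge_parent]), so that addresses are defined and
    injective ([address_inj]). Counting the vertices level by level shows that
    the graph has enough edges for all the labels in use to be allowed
    ([card_edges_ge]). *)

Set Implicit Arguments.
Unset Strict Implicit.
Unset Printing Implicit Defensive.

(** * The labelling of binary words *)

(** [n] is the number of levels below the empty word, and the letter next to the
    root comes first, so that it selects the copy of the smaller tree. The
    reflection that brings the root label back to 0 is built in: with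
    [M = (2 ^ n).-1], the two values of the shift, 0 and [M], turn
    [2 * M - (shift + label)] into the two cases below. *)
Fixpoint word_label (n : nat) (w : seq bool) : nat :=
  if n is n'.+1 then
    if w is b :: w' then
      (if b (+) odd (size w') then 2 else 1) * (2 ^ n).-1 - word_label n' w'
    else 0
  else 0.

Lemma word_label_nil n : word_label n [::] = 0.
Proof. by case: n. Qed.

Lemma word_label_cons n b w :
  word_label n.+1 (b :: w) =
  (if b (+) odd (size w) then 2 else 1) * (2 ^ n.+1).-1 - word_label n w.
Proof. by []. Qed.

Lemma word_label_lt n w : word_label n w < (2 ^ n.+1).-1.
Proof.
elim: n w => [|n IHn] [|b w] //; have := expn_gt0 2 n; rewrite ?word_label_nil.
  by rewrite !expnS; lia.
by rewrite word_label_cons (expnS 2 n.+1); have := IHn w; case: ifP; lia.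
Qed.

Lemma word_label_inj n : {in [pred w | size w <= n] &, injective (word_label n)}.
Proof.
elim: n => [|n IHn] [|b w] [|b' w'] //; rewrite !inE /= => szw szw'.
- by have := word_label_lt n w'; case: ifP; lia.
- by have := word_label_lt n w; case: ifP; lia.
have lt_w := word_label_lt n w; have lt_w' := word_label_lt n w'.
move=> eq_lab.
have eq_ww' : w = w' by apply: IHn => //; move: eq_lab; do 2 case: ifP; lia.
subst w'; congr (_ :: _); move: eq_lab.
by case: b; case: b'; case: (odd _) => //=; lia.
Qed.

Definition word_edge_label n w b :=
  `|word_label n (rcons w b) - word_label n w|%N.

Lemma word_edge_gt0 n w b : size w < n -> 0 < word_edge_label n w b.
Proof.
move=> szw; rewrite /word_edge_label.
suff: word_label n (rcons w b) <> word_label n w by lia.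
move/word_label_inj; rewrite !inE size_rcons => /(_ szw (ltnW szw)).
by move/(congr1 size); rewrite size_rcons; lia.
Qed.

(** An edge inside a copy of the smaller tree, of label [d] there, gets [M + d] or
    [M - d], because its two ends have opposite parities and hence different
    shifts. For a fixed edge the sign changes with [a], so that its two copies
    share out [M + d] and [M - d]. *)
Lemma word_edge_cons n a w b :
  word_edge_label n.+1 (a :: w) b =
  if a (+) odd (size w) then
    (2 ^ n.+1).-1 + word_label n (rcons w b) - word_label n w
  else (2 ^ n.+1).-1 + word_label n w - word_label n (rcons w b).
Proof.
rewrite /word_edge_label rcons_cons !word_label_cons size_rcons /=.
have := word_label_lt n w; have := word_label_lt n (rcons w b).
by case: a; case: (odd _) => /=; lia.
Qed.

Lemma word_edge_nil n b :
  word_edge_label n.+1 [::] b = (if b then 2 else 1) * (2 ^ n.+1).-1.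
Proof.
by rewrite /word_edge_label [rcons _ _]/= word_label_cons !word_label_nil;
  case: b => /=; lia.
Qed.

(** The edges at the root have labels [M] and [2 * M], which the copies avoid
    since [0 < d < M]. Inside the copies the distance to [M] gives back [d], hence
    the edge by induction, and then the sign tells the copy. *)
Lemma word_edge_inj n w b w' b' :
  size w < n -> size w' < n ->
  word_edge_label n w b = word_edge_label n w' b' -> w = w' /\ b = b'.
Proof.
elim: n w b w' b' => [|n IHn] // [|a w] b [|a' w'] b' /= szw szw'.
- rewrite !word_edge_nil => eq_lab; split=> //.
  have := expn_gt0 2 n; move: eq_lab; rewrite expnS.
  by case: b; case: b' => //; lia.
- have lab_neq := word_edge_gt0 b' szw'; rewrite /word_edge_label in lab_neq.
  have := word_label_lt n w'; have := word_label_lt n (rcons w' b').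
  by rewrite word_edge_nil word_edge_cons; do 2 case: ifP; lia.
- have lab_neq := word_edge_gt0 b szw; rewrite /word_edge_label in lab_neq.
  have := word_label_lt n w; have := word_label_lt n (rcons w b).
  by rewrite word_edge_nil word_edge_cons; do 2 case: ifP; lia.
have lab_neq := word_edge_gt0 b szw; rewrite /word_edge_label in lab_neq.
have lt_w := word_label_lt n w; have lt_wb := word_label_lt n (rcons w b).
have lt_w' := word_label_lt n w'; have lt_wb' := word_label_lt n (rcons w' b').
rewrite !word_edge_cons => eq_lab.
have [eq_w eq_b] : w = w' /\ b = b'.
  apply: IHn => //; rewrite /word_edge_label.
  by move: eq_lab; do 2 case: ifP; lia.
split=> //; rewrite -{}eq_w -{}eq_b in eq_lab *; congr (_ :: _); move: eq_lab.
by case: a; case: a'; case: (odd _) => //=; lia.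
Qed.

(** For [0 < n] the threshold is the label [2 ^ n - 1] of one of the two daughters
    of the root, which is why the inequalities cannot be strict. *)
Lemma word_label_split n :
  exists2 k, 0 < k & forall w b, size w < n ->
    word_label n w <= k <= word_label n (rcons w b) \/
    word_label n (rcons w b) <= k <= word_label n w.
Proof.
case: n => [|n]; first by exists 1.
exists (2 ^ n.+1).-1 => [|[|a w] b _].
- by have := expn_gt0 2 n; rewrite expnS; lia.
- by left; rewrite [rcons _ _]/= word_label_cons !word_label_nil; case: ifP; lia.
rewrite rcons_cons !word_label_cons size_rcons /=.
have := word_label_lt n w; have := word_label_lt n (rcons w b).
by case: a; case: (odd _) => /=; lia.
Qed.

(** * Distance and parents in a tree *)

Section Distance.
Variables (T : finType) (e : rel T) (r : T).

Lemma dist_le p : path e r p -> size p < #|T| -> dist e r (last r p) <= size p.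
Proof.
move=> pp szp; rewrite leqNgt; apply/negP => /(before_find 0).
rewrite nth_iota // add0n => /existsP[]; exists (in_tuple p).
by rewrite /= pp eqxx.
Qed.

Lemma dist_walk v : connect e r v ->
  exists p, [/\ path e r p, last r p = v & size p = dist e r v].
Proof.
case/connectP => p /shortenP[q pq uq _] ->.
have szq : size q < #|T| by have := max_card [in r :: q]; rewrite (card_uniqP uq).
set v' := last r q.
have dlt : dist e r v' < #|T| by apply: leq_ltn_trans (dist_le pq szq) szq.
have hasd : has (fun n => [exists p : n.-tuple T, path e r p && (last r p == v')])
                (iota 0 #|T|) by rewrite has_find size_iota.
have := nth_find 0 hasd; rewrite -/(dist e r v') nth_iota // add0n.
case/existsP=> t /andP[pt /eqP lt]; exists t; split=> //.
by rewrite size_tuple.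
Qed.

Lemma dist_root : dist e r r = 0.
Proof.
have := @dist_le [::] isT; rewrite /= leqn0 => dist0; apply/eqP/dist0.
by apply/card_gt0P; exists r.
Qed.

Lemma dist_pred v : symmetric e -> (forall x y, connect e x y) -> v != r ->
  exists u, e v u && (dist e r v == (dist e r u).+1).
Proof.
move=> symE conE vr; have [p [pp lp szp]] := dist_walk (conE r v).
case/lastP: p pp lp szp => [|p x]; first by move=> _ /= rv; rewrite rv eqxx in vr.
rewrite rcons_path last_rcons size_rcons => /andP[pp ex] xv szp; subst x.
exists (last r p); rewrite symE ex /= eqn_leq; apply/andP; split; last first.
  have [q [pq lq szq]] := dist_walk (conE r v).
  have dlt : dist e r v <= #|T|.
    by rewrite -[leqRHS](size_iota 0); exact: find_size.
  by rewrite -szp ltnS dist_le //; move: dlt; rewrite -szp.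
have [q [pq lq szq]] := dist_walk (conE r (last r p)).
have pqv : path e r (rcons q v) by rewrite rcons_path pq lq.
(* [dist] only searches walks shorter than [#|T|], but never exceeds [#|T|], so
   the bound survives when the extended walk is too long. *)
have [szlt|szge] := ltnP (size (rcons q v)) #|T|.
  by have := dist_le pqv szlt; rewrite last_rcons size_rcons szq.
rewrite -szq; rewrite size_rcons in szge; apply: leq_trans szge.
by rewrite -[leqRHS](size_iota 0); exact: find_size.
Qed.

End Distance.

(** In an acyclic graph an edge is a bridge: a path between its ends in the rest
    of the graph would close up to a cycle. *)
Lemma edge_bridge (T : finType) (e e' : rel T) (x y : T) :
  (forall c : seq T, 2 < size c -> uniq c -> ~~ cycle e c) ->
  subrel e' e -> ~~ e' y x -> x != y -> e x y -> ~~ connect e' y x.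
Proof.
move=> acyc sub nyx xy exy; apply/negP => /connectP[p].
case/shortenP => q pq uq _ xq.
have := acyc (y :: q); rewrite (cycle_path y) /= => /(_ _ uq)/negP[]; last first.
  by rewrite -xq exy /=; apply: sub_path pq.
case: q pq {uq} xq => [|z [|t q]] //=; first by move=> _ /eqP; rewrite (negPf xy).
by rewrite andbT => eyz xz; rewrite xz eyz in nyx.
Qed.

Section Parent.
Variables (T : finType) (e : rel T) (r : T).
Hypothesis treeE : is_tree e.

Let depth := dist e r.

Definition parent v : T := odflt v [pick u | e v u && (depth v == (depth u).+1)].

Lemma parentP v : v != r -> e v (parent v) /\ depth v = (depth (parent v)).+1.
Proof.
case: treeE => symE _ conE _ vr; rewrite /parent; case: pickP => [u|none] /=.
  by case/andP=> -> /eqP.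
by have [u] := dist_pred symE conE vr; rewrite -/depth none.
Qed.

Lemma depth_gt0 v : 0 < depth v -> v != r.
Proof. by apply: contraTneq => ->; rewrite /depth dist_root. Qed.

Lemma depth_eq0 v : depth v = 0 -> v = r.
Proof. by have [//|/parentP[_ ->]] := eqVneq v r. Qed.

Definition parent_rel u v :=
  ((u != r) && (v == parent u)) || ((v != r) && (u == parent v)).

Lemma parent_rel_connect v : connect parent_rel v r.
Proof.
have [n] := ubnP (depth v); elim: n v => // n IHn v ltvn.
have [->|vr] := eqVneq v r; first exact: connect0.
have [_ dv] := parentP vr.
apply: connect_trans (IHn (parent v) _); last by rewrite -ltnS -dv.
by apply: connect1; rewrite /parent_rel vr eqxx.
Qed.

(** The edges to the chosen parents already connect the graph, so a further edge
    could not be a bridge. This gives at once that parents are unique and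
    that no edge joins two vertices of the same level. *)
Lemma edge_parent u v : e u v = parent_rel u v.
Proof.
have [symE irrE conE acyc] := treeE.
have sub : subrel parent_rel e.
  move=> x y /orP[] /andP[zr /eqP->]; first by case: (parentP zr).
  by rewrite symE; case: (parentP zr).
have symP : symmetric parent_rel by move=> x y; rewrite /parent_rel orbC.
apply/idP/idP => [euv|/sub//]; apply: contraT => nuv.
have uv : u != v by apply: contraTneq euv => ->; rewrite irrE.
have := edge_bridge acyc sub _ uv euv; rewrite symP => /(_ nuv)/negP[].
apply: connect_trans (parent_rel_connect v) _.
by rewrite sym_connect_sym ?parent_rel_connect.
Qed.

Lemma daughtersE v : daughters e r v = [set w | (w != r) && (parent w == v)].
Proof.
apply/setP => w; rewrite !inE edge_parent /level eqSS /parent_rel -/depth.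
apply/idP/idP => [/andP[/orP[]/andP[zr /eqP eqp]]|/andP[wr /eqP<-]].
- by move/eqP; have [_] := parentP zr; rewrite -eqp; lia.
- by rewrite zr eqp eqxx.
by have [_ ->] := parentP wr; rewrite wr !eqxx orbT.
Qed.

Lemma card_edges_parent : #|T|.-1 <= #|edges e|.
Proof.
have -> : #|T|.-1 = #|[set [set v; parent v] | v in [set~ r]]|.
  rewrite card_in_imset ?cardsC1 // => v w; rewrite !inE => vr wr eqvw.
  have : v \in [set w; parent w] by rewrite -eqvw !inE eqxx.
  have : w \in [set v; parent v] by rewrite eqvw !inE eqxx.
  rewrite !inE => /orP[/eqP //|/eqP eqw] /orP[/eqP //|/eqP eqv].
  have [_] := parentP vr; have [_] := parentP wr; rewrite -eqv -eqw; lia.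
apply/subset_leq_card/subsetP => _ /imsetP[v vr ->]; rewrite !inE in vr.
apply/imsetP; exists (v, parent v) => //; rewrite inE /=.
by case: (parentP vr).
Qed.

(** * Binary trees *)

Variable m : nat.
Hypothesis binE : daughter_degree_sequence e r (nseq m 2).

Lemma depth_le v : depth v <= m.
Proof.
have [szm _] := binE; rewrite size_nseq in szm.
have := leq_bigmax (F := level e r) v; rewrite -/(last_level e r) /level -/depth.
by rewrite szm; lia.
Qed.

Lemma card_daughters v : #|[set w | (w != r) && (parent w == v)]| = (depth v < m) * 2.
Proof.
have [_ card_d] := binE; rewrite -daughtersE card_d /level /= -/depth nth_nseq.
by case: ifP.
Qed.

Lemma card_level i : i <= m -> #|[set v | depth v == i]| = 2 ^ i.
Proof.
elim: i => [|i IHi] lei.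
  rewrite expn0 -(cards1 r); apply: eq_card => v; rewrite !inE.
  by apply/eqP/eqP => [/depth_eq0|->] //; rewrite /depth dist_root.
rewrite -sum1_card (partition_big parent [in [set v | depth v == i]]) /=; last first.
  move=> v; rewrite !inE => /eqP dv.
  have /parentP[_] : v != r by rewrite depth_gt0 ?dv.
  by rewrite dv => -[->].
rewrite expnSr -IHi 1?ltnW // -sum_nat_const; apply: eq_bigr => u.
rewrite inE => /eqP du; have := card_daughters u; rewrite du lei mul1n => <-.
rewrite -sum1_card; apply: eq_bigl => v; rewrite !inE.
have [eqp|] := eqVneq (parent v) u; rewrite ?andbF // !andbT.
apply/eqP/idP => [dv|vr]; first by rewrite depth_gt0 ?dv.
by have [_ ->] := parentP vr; rewrite eqp du.
Qed.

Lemma card_edges_ge : (2 ^ m.+1).-2 <= #|edges e|.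
Proof.
suff -> : (2 ^ m.+1).-2 = #|T|.-1 by exact: card_edges_parent.
congr _.-1; rewrite predn_exp mul1n -sum1_card.
rewrite (partition_big (fun v => inord (depth v) : 'I_m.+1) xpredT) //=.
apply: eq_bigr => i _; rewrite -(@card_level i) -1?ltnS // -sum1_card.
apply: eq_bigl => v; rewrite !inE -val_eqE /= inordK //.
by rewrite ltnS depth_le.
Qed.

Definition side v : bool :=
  0 < index v (enum [set w | (w != r) && (parent w == parent v)]).

Lemma side_inj u v :
  u != r -> v != r -> parent u = parent v -> side u = side v -> u = v.
Proof.
move=> ur vr eqp; rewrite /side eqp; set D := [set w | _].
have uD : u \in enum D by rewrite mem_enum inE ur eqp eqxx.
have vD : v \in enum D by rewrite mem_enum inE vr eqxx.
have szD : size (enum D) <= 2 by rewrite -cardE card_daughters; case: (_ < _).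
move=> eqs; rewrite -(nth_index r uD) -(nth_index r vD); congr nth.
move: szD uD vD eqs; rewrite -!index_mem.
by move: (size _) (index u _) (index v _) => n i j; lia.
Qed.

(** The recursion is on the number of steps up, since [parent] decreases the depth
    only away from the root. The last letter is the side of [v] itself. *)
Fixpoint ancestor_sides n v : seq bool :=
  if n is n'.+1 then rcons (ancestor_sides n' (parent v)) (side v) else [::].

Definition address v := ancestor_sides (depth v) v.

Lemma addressE v : v != r -> address v = rcons (address (parent v)) (side v).
Proof. by rewrite /address => /parentP[_ ->]. Qed.

Lemma size_address v : size (address v) = depth v.
Proof.
rewrite /address; elim: (depth v) {2}v => //= n IHn u.
by rewrite size_rcons IHn.
Qed.

Lemma address_inj : injective address.
Proof.
move=> u; have [n] := ubnP (depth u); elim: n u => // n IHn u ltun v eqa.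
have eqd : depth u = depth v by rewrite -!size_address eqa.
have [ur|ur] := eqVneq u r.
  by rewrite ur; apply/esym/depth_eq0; rewrite -eqd ur /depth dist_root.
have [_ du] := parentP ur.
have vr : v != r by rewrite depth_gt0 // -eqd du.
move: eqa; rewrite (addressE ur) (addressE vr) => /rcons_inj[eqa eqs].
by apply: side_inj => //; apply: IHn => //; rewrite -ltnS -du.
Qed.

Definition tree_label v := word_label m (address v).

Lemma tree_edge_label v : v != r ->
  edge_label tree_label v (parent v) =
  word_edge_label m (address (parent v)) (side v).
Proof. by move=> vr; rewrite /edge_label /tree_label addressE. Qed.

Lemma size_parent_address v : v != r -> size (address (parent v)) < m.
Proof. by move=> /parentP[_ dv]; rewrite size_address -dv depth_le. Qed.

Lemma edge_labelC u v : edge_label tree_label u v = edge_label tree_label v u.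
Proof. exact: distnC. Qed.

(** Edge labels and edges are symmetric in the two ends, so that gracefulness can
    be checked on the pairs [(w, parent w)] only. *)
Lemma edge_child u v : e u v -> exists w, [/\ w != r, [set u; v] = [set w; parent w]
  & edge_label tree_label u v = edge_label tree_label w (parent w)].
Proof.
rewrite edge_parent => /orP[]/andP[zr /eqP->]; first by exists u.
by exists v; split=> //; [exact: setUC | exact: edge_labelC].
Qed.

Lemma tree_label_graceful : graceful e tree_label.
Proof.
have lab_le v : tree_label v <= #|edges e|.
  apply: leq_trans card_edges_ge; have := word_label_lt m (address v).
  by rewrite /tree_label; lia.
split=> // [u v|u v euv|u v u' v'].
- move=> eql; apply/address_inj/(word_label_inj _ _ eql); rewrite inE size_address;
  exact: depth_le.
- have le_uv : edge_label tree_label u v <= #|edges e|.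
    by rewrite /edge_label; have := lab_le u; have := lab_le v; lia.
  rewrite le_uv andbT; have [w [wr _ ->]] := edge_child euv.
  by rewrite tree_edge_label // word_edge_gt0 // size_parent_address.
move=> /edge_child[w [wr -> ->]] /edge_child[w' [wr' -> ->]].
rewrite !tree_edge_label // => /word_edge_inj[||eqa eqs];
  try exact: size_parent_address.
by rewrite (side_inj wr wr' (address_inj eqa) eqs).
Qed.

Lemma tree_label_weakly_alpha : weakly_alpha e tree_label.
Proof.
split; first exact: tree_label_graceful.
have [k k_gt0 splitk] := word_label_split m; exists k; split=> // x y.
have split_parent v : v != r ->
  tree_label (parent v) <= k <= tree_label v \/
  tree_label v <= k <= tree_label (parent v).
  move=> vr; rewrite {2 3}/tree_label (addressE vr).
  exact/splitk/size_parent_address.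
rewrite edge_parent => /orP[]/andP[/split_parent sp /eqP->] //.
by case: sp; [right | left].
Qed.

End Parent.

Theorem corollary1 (T : finType) (e : rel T) (r : T) (m : nat) :
  rooted_symmetric_tree e r ->
  daughter_degree_sequence e r (nseq m 2) ->
  exists f : T -> nat, weakly_alpha e f.
Proof.
by case=> treeE _ binE; exists (tree_label e r m); exact: tree_label_weakly_alpha.
Qed.
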